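(* Let $n\ge 1$ and let $D^\circ=\{z\in\mathbf{C}^n: |z_1|+\cdots+|z_n|<1\}$ be the unit hypercone. Then $$B_n(D^\circ)<\frac{0.446663}{n}.$$
   Context: Multi-indices $\alpha=(\alpha_1,\dots,\alpha_n)$ have non-negative integer entries and $z^\alpha=z_1^{\alpha_1}\cdots z_n^{\alpha_n}$. For a complete $n$-circular (complete Reinhardt) domain $D\subset\mathbf{C}^n$ and $r>0$ put $D_r=r\cdot D=\{rz: z\in D\}$. $B_n(D)$ denotes the largest number (supremum of the numbers) $r>0$ with the following property: for every power series $\sum_\alpha c_\alpha z^\alpha$ that converges in $D$ and satisfies $\left|\sum_\alpha c_\alpha z^\alpha\right|<1$ for all $z\in D$, one has $$\sum_\alpha \sup_{z\in D_r}|c_\alpha z^\alpha|<1.$$ *)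

(* Defs.v *)
From HB Require Import structures.
From mathcomp Require Import all_boot all_order all_algebra finmap.
From mathcomp Require Import all_classical all_reals all_analysis.
From mathcomp Require Import complex.
From mathcomp Require Import summability.

Set Implicit Arguments.
Unset Strict Implicit.
Unset Printing Implicit Defensive.

Import Order.TTheory GRing.Theory Num.Theory.
Import numFieldNormedType.Exports.
Import ComplexField.Normc.

Local Open Scope classical_set_scope.
Local Open Scope ring_scope.
Local Open Scope complex_scope.

Definition multi_index (n : nat) := {ffun 'I_n -> nat}.

Section Bohr.
Context {R : realType} {n : nat}.
Implicit Types (D : set 'rV[R[i]]_n) (c : multi_index n -> R[i]).

Definition monomial (z : 'rV[R[i]]_n) (a : multi_index n) : R[i] :=
  \prod_(i < n) z ord0 i ^+ a i.

Definition dilate (r : R) D : set 'rV[R[i]]_n := [set r%:C *: z | z in D].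

(* A multiple power series has no preferred order of summation: its value is
   the limit of the finite partial sums along the directed set of finite sets
   of multi-indices, so that convergence is absolute convergence. *)
Definition power_series_partial c (z : 'rV[R[i]]_n) :
    {fset multi_index n} -> (R[i])^o :=
  partial_sum (fun a => c a * monomial z a : (R[i])^o).

Definition power_series_cvg c (z : 'rV[R[i]]_n) : Prop :=
  cvg (power_series_partial c z @ totally).

Definition power_series_sum c (z : 'rV[R[i]]_n) : R[i] :=
  lim (power_series_partial c z @ totally).

(* The sum and the suprema are taken in the extended reals, where they always
   exist. *)
Definition majorant_sum D (r : R) c : \bar R :=
  \esum_(a in [set: multi_index n])
    ereal_sup [set (normc (c a * monomial z a))%:E | z in dilate r D].

Definition bohr_property D (r : R) : Prop :=
  forall c,
    (forall z, D z -> power_series_cvg c z) ->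
    (forall z, D z -> normc (power_series_sum c z) < 1) ->
    (majorant_sum D r c < 1)%E.

(* The supremum is +oo if the property holds for arbitrarily large r. *)
Definition bohr_radius D : \bar R :=
  ereal_sup [set r%:E | r in [set r : R | 0 < r /\ bohr_property D r]].

End Bohr.

Definition hypercone (R : realType) (n : nat) : set 'rV[R[i]]_n :=
  [set z | \sum_(i < n) normc (z ord0 i) < 1].

Arguments hypercone : clear implicits.

(* Main.v *)
(* Test the Bohr property on [phi (z_1 + ... + z_n)], where
   [phi w = (a - w) / (1 - a w) = a - (1 - a^2) \sum_(k >= 1) a^(k-1) w^k]
   maps the unit disc into itself. Since
   [(z_1 + ... + z_n)^k = \sum_(|al| = k) multinomial al * z^al], where the
   multinomial coefficients add up to [n^k], and since the supremum of [|z^al|]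
   on the hypercone dilated by [r] is
   [(r / k)^k \prod_i (al i)^(al i) >= (r / k)^k], the majorant sum is at least
   [a + (1 - a^2) \sum_(k >= 1) a^(k-1) (n r / k)^k].
   As [a] tends to [1] this exceeds [1] as soon as
   [\sum_(k >= 1) (n r / k)^k > 1 / 2], which holds slightly below
   [n r = 0.446663]; five terms of the sum and [a = 1 - 10^-7] suffice. *)

Require Import Defs.
From mathcomp Require Import all_boot all_order all_algebra.
From mathcomp Require Import all_classical all_reals all_analysis.
From mathcomp Require Import finmap complex summability ring lra.

Set Implicit Arguments.
Unset Strict Implicit.
Unset Printing Implicit Defensive.
Import Order.TTheory GRing.Theory Num.Theory.
Import numFieldNormedType.Exports ComplexField.Normc.
Local Open Scope ring_scope.
Local Open Scope complex_scope.

#[local] Existing Instance totally_filter.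

(** * Complex norms and a geometric tail *)

Section complex_norm.
Context {R : realType}.

Lemma normr_normc (x : R[i]) : `|x| = (normc x)%:C.
Proof. by []. Qed.

Lemma normc_ge0 (x : R[i]) : 0 <= normc x.
Proof. by case: x => x y; exact: sqrtr_ge0. Qed.

Lemma normc_real (x : R) : normc x%:C = `|x|.
Proof. by rewrite /= expr0n /= addr0 sqrtr_sqr. Qed.

Lemma real_complex_sum (I : Type) (r : seq I) (F : I -> R) :
  (\sum_(i <- r) F i)%:C = \sum_(i <- r) (F i)%:C.
Proof. exact: (rmorph_sum (real_complex R)). Qed.

End complex_norm.

Lemma sum_geometric_le (R : realFieldType) (s : R) K M : 0 <= s < 1 ->
  \sum_(K <= k < M) s ^+ k <= s ^+ K / (1 - s).
Proof.
move=> /andP[s0 s1]; have s1' : 0 < 1 - s by rewrite subr_gt0.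
have [MK|KM] := leqP M K.
  by rewrite big_geq // divr_ge0 ?exprn_ge0 // ltW.
rewrite ler_pdivlMr // mulrC mulr_sumr.
rewrite (eq_bigr (fun k => - (s ^+ k.+1 - s ^+ k))); last first.
  by move=> k _; rewrite exprS; ring.
by rewrite sumrN telescope_sumr ?(ltnW KM) // opprB lerBlDr lerDl exprn_ge0.
Qed.

(** * Words and multi-indices *)

Definition degree n (al : multi_index n) : nat := (\sum_(i < n) al i)%N.

(** A word [f] stands for one term of an expanded [k]-th power of a sum; its content is the exponent
    of the monomial that this term gives. *)
Definition content k n (f : {ffun 'I_k -> 'I_n}) : multi_index n :=
  [ffun i => #|[pred j | f j == i]|].

(* The number of words whose content is [al] is the multinomial coefficient
   [(degree al)`! / \prod_i (al i)`!]; the factorials are never needed. *)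
Definition multinomial n (al : multi_index n) : nat :=
  #|[pred f : {ffun 'I_(degree al) -> 'I_n} | content f == al]|.

(** Built from words, of which there are finitely many, so that no separate finiteness argument is
    needed. *)
Definition contents_below n K : {fset multi_index n} :=
  seq_fset tt [seq content (tagged u) | u : {k : 'I_K & {ffun 'I_k -> 'I_n}}].

Lemma degree_content k n (f : {ffun 'I_k -> 'I_n}) : degree (content f) = k.
Proof.
rewrite -[RHS]card_ord -sum1_card (partition_big f xpredT) //=.
by apply: eq_bigr => i _; rewrite ffunE sum1_card.
Qed.

Lemma content_in_contents_below k n K (f : {ffun 'I_k -> 'I_n}) :
  (k < K)%N -> content f \in contents_below n K.
Proof.
move=> kK; rewrite seq_fsetE.
apply/mapP; exists (Tagged (fun k : 'I_K => {ffun 'I_k -> 'I_n})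
  (f : {ffun 'I_(Ordinal kK) -> 'I_n})) => //.
exact: mem_enum.
Qed.

Lemma degree_contents_below n K (al : multi_index n) :
  al \in contents_below n K -> (degree al < K)%N.
Proof.
by rewrite seq_fsetE => /mapP[[k f] _ ->]; rewrite degree_content ltn_ord.
Qed.

Lemma prod_content (R : comPzRingType) k n (z : 'I_n -> R)
    (f : {ffun 'I_k -> 'I_n}) :
  \prod_i z i ^+ content f i = \prod_j z (f j).
Proof.
rewrite [RHS](partition_big f xpredT) //=.
apply: eq_bigr => i _; rewrite ffunE -prodr_const.
by apply: eq_big => [j|j /eqP ->].
Qed.

(** Double counting: each word of length [k] has exactly one content, and that content has degree
    [k]. *)
Lemma sum_multinomial_degree (V : nmodType) n (A : {fset multi_index n})
    (G : multi_index n -> V) k :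
  \sum_(al <- A | degree al == k) G al *+ multinomial al =
  \sum_(f : {ffun 'I_k -> 'I_n} | content f \in A) G (content f).
Proof.
rewrite (eq_bigr (fun f => \sum_(al <- A | al == content f) G al)); last first.
  move=> f fA; rewrite (eq_bigr (fun=> G (content f))); last first.
    by move=> al /eqP ->.
  by rewrite big_const_seq count_uniq_mem ?fset_uniq // fA /= addr0.
rewrite big_mkcond /=.
rewrite [RHS](_ : _ = \sum_(f : {ffun 'I_k -> 'I_n})
    \sum_(al <- A | al == content f) G al); last first.
  rewrite big_mkcond; apply: eq_bigr => f _; case: ifPn => // fA.
  rewrite big_seq_cond big1 // => al /andP[alA /eqP alf].
  by rewrite -alf alA in fA.
rewrite (exchange_big_dep xpredT) //=.
apply: eq_bigr => al _; case: eqP => [<-|alk].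
  rewrite -sumr_const; apply: eq_bigl => f; exact: eq_sym.
rewrite big_pred0 // => f; apply/eqP => alf.
by apply: alk; rewrite alf degree_content.
Qed.

Lemma sum_multinomial (V : nmodType) n (A : {fset multi_index n})
    (G : multi_index n -> V) M :
  {in A, forall al, degree al < M}%N ->
  \sum_(al <- A) G al *+ multinomial al =
  \sum_(k < M) \sum_(f : {ffun 'I_k -> 'I_n} | content f \in A) G (content f).
Proof.
move=> AM; under [RHS]eq_bigr do rewrite -sum_multinomial_degree.
rewrite (exchange_big_dep xpredT) //= [LHS]big_seq [RHS]big_seq.
apply: eq_bigr => al /AM alM.
by rewrite (big_pred1 (Ordinal alM)) // => k; rewrite eq_sym -val_eqE.
Qed.

Lemma sum_expr_words (R : comPzRingType) k n (z : 'I_n -> R) :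
  (\sum_i z i) ^+ k = \sum_(f : {ffun 'I_k -> 'I_n}) \prod_j z (f j).
Proof.
by rewrite -[in LHS](card_ord k) -prodr_const bigA_distr_bigA.
Qed.

(** * Power series in the sum of the variables *)

Section diagonal_series.
Context {R : realType} {n : nat}.
Implicit Types (b : nat -> R) (z : 'rV[R[i]]_n).

(* Coefficients of [\sum_k b k * (z_1 + ... + z_n) ^+ k]. *)
Definition diagonal_coef b (al : multi_index n) : R[i] :=
  (b (degree al))%:C *+ multinomial al.

Lemma sum_diagonal b z (A : {fset multi_index n}) M :
  {in A, forall al, degree al < M}%N ->
  partial_sum (fun al => diagonal_coef b al * monomial z al) A =
  \sum_(k < M) (b k)%:C *
    \sum_(f : {ffun 'I_k -> 'I_n} | content f \in A) \prod_j z ord0 (f j).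
Proof.
move=> AM; rewrite /partial_sum.
rewrite -(big_seq_fsetE _ _ xpredT
  (fun al => diagonal_coef b al * monomial z al)) /=.
rewrite (eq_bigr (fun al =>
    ((b (degree al))%:C * monomial z al) *+ multinomial al)); last first.
  by move=> al _; rewrite /diagonal_coef mulrnAl.
rewrite (sum_multinomial _ AM); apply: eq_bigr => k _; rewrite mulr_sumr.
apply: eq_bigr => f _; rewrite degree_content; congr (_ * _).
exact: (prod_content (z ord0)).
Qed.

(** In degrees below [K] the set [A] contains the content of every word, so the terms cancel. In
    each higher degree only the words with content outside [A] remain; they are part of the
    expansion of the [k]-th power of the sum of the moduli. *)
Lemma partial_sum_diagonal_dist b z (A : {fset multi_index n}) K M :
    (forall k, `|b k| <= 1) ->
    (contents_below n K `<=` A)%fset ->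
    {in A, forall al, degree al < M}%N -> (K <= M)%N ->
  `|partial_sum (fun al => diagonal_coef b al * monomial z al) A -
    \sum_(k < M) (b k)%:C * (\sum_i z ord0 i) ^+ k| <=
  \sum_(K <= k < M) (\sum_i `|z ord0 i|) ^+ k.
Proof.
move=> b1 KA AM KM; rewrite (sum_diagonal _ _ AM) -sumrB.
apply: (le_trans (ler_norm_sum _ _ _)).
rewrite -(big_mkord xpredT (fun k => `|(b k)%:C *
    (\sum_(f : {ffun 'I_k -> 'I_n} | content f \in A) \prod_j z ord0 (f j)) -
  (b k)%:C * (\sum_i z ord0 i) ^+ k|)).
rewrite (@big_cat_nat _ _ _ K) //=.
rewrite [X in X + _]big_nat_cond big1 ?add0r; last first.
  move=> k /andP[/andP[_ kK] _].
  rewrite sum_expr_words (eq_bigl xpredT) ?subrr ?normr0 //.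
  by move=> f; rewrite (fsubsetP KA) // content_in_contents_below.
apply: ler_sum => k _; rewrite -mulrBr normrM.
apply: (@le_trans _ _ (1 * (\sum_i `|z ord0 i|) ^+ k)); last by rewrite mul1r.
apply: ler_pM => //.
  by rewrite normr_normc normc_real lecR.
rewrite !sum_expr_words [X in _ - X](bigID (fun f => content f \in A)) /=.
rewrite opprD addrA subrr add0r normrN.
apply: (le_trans (ler_norm_sum _ _ _)).
rewrite [X in _ <= X](bigID (fun f => content f \in A)) /=.
rewrite (eq_bigr (fun f : {ffun 'I_k -> 'I_n} =>
    \prod_j `|z ord0 (f j)|)); last by move=> f _; rewrite normr_prod.
by rewrite ler_wpDl // sumr_ge0 // => f _; apply: prodr_ge0.
Qed.

Lemma diagonal_series_cvg b z (L : (R[i])^o) :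
    let s := \sum_i normc (z ord0 i) in s < 1 ->
    (forall k, `|b k| <= 1) ->
    (forall M, `|L - \sum_(k < M.+1) (b k)%:C * (\sum_i z ord0 i) ^+ k|
      <= (s ^+ M.+1 / (1 - s))%:C) ->
  (power_series_partial (diagonal_coef b) z @ totally --> L)%classic.
Proof.
move=> s s1 b1 bL; have s0 : 0 <= s.
  by apply: sumr_ge0 => i _; exact: normc_ge0.
apply/cvgrPdist_le => e e0.
(* A positive element of [R[i]] is real. *)
have [e' ee] : exists e', e = e'%:C by apply/complex_realP/gtr0_real.
rewrite {}ee ltcR in e0 *.
have /cvg_expr/cvgrPdist_lt : `|s| < 1 by rewrite ger0_norm.
(* Two errors, each at most [s ^+ K.+1 / (1 - s)], must fit into [e']: the words missing from [A]
   and the remainder of the series in one variable. *)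
move=> /(_ (e' * (1 - s) / 2)) [|K _ HK].
  by rewrite divr_gt0 // mulr_gt0 // subr_gt0.
have {HK} := HK _ (leqnSn K).
rewrite sub0r normrN ger0_norm ?exprn_ge0 // => sK.
exists (contents_below n K.+1) => // A /= KA.
(* Truncating at [M] covers all degrees in [A] and is no earlier than [K]. *)
pose M := maxn K (\max_(al <- A) degree al).
have AM : {in A, forall al, degree al < M.+1}%N.
  move=> al alA; rewrite ltnS /M leq_max; apply/orP; right.
  by rewrite (big_rem al) //= leq_maxl.
have KM : (K.+1 <= M.+1)%N by rewrite ltnS leq_maxl.
have := partial_sum_diagonal_dist z b1 KA AM KM.
have := bL M.
set S := \sum_(k < M.+1) _ => LS PS.
rewrite /power_series_partial -(subrKA S).
apply: (le_trans (ler_normD _ _)).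
rewrite [X in _ + X]distrC.
apply: (le_trans (lerD LS PS)).
rewrite -real_complex_sum (eq_bigr (fun k => (s ^+ k)%:C)); last first.
  by move=> k _; rewrite -rmorphXn.
rewrite -real_complex_sum -rmorphD lecR.
have s1' : 0 < 1 - s by rewrite subr_gt0.
have sMK : s ^+ M.+1 / (1 - s) <= s ^+ K.+1 / (1 - s).
  rewrite ler_pM2r ?invr_gt0 //; apply: ler_wiXn2l => //; exact: ltW.
apply: (le_trans (lerD sMK (sum_geometric_le _ _ _))); first by rewrite s0.
rewrite -mulrDl ler_pdivrMr // -mulr2n -mulr_natr; lra.
Qed.

End diagonal_series.

(** * The disc automorphism *)

Section moebius.
Context {R : realType}.
Variable a : R.
Hypothesis a01 : 0 < a < 1.

Definition moebius (w : R[i]) : R[i] := (a%:C - w) / (1 - a%:C * w).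

Definition moebius_coef (k : nat) : R :=
  if k is k'.+1 then - ((1 - a ^+ 2) * a ^+ k') else a.

Lemma moebius_coef_le1 k : `|moebius_coef k| <= 1.
Proof.
have /andP[a0 a1] := a01; case: k => [|k] /=; first by rewrite gtr0_norm // ltW.
rewrite normrN normrM ger0_norm; last by rewrite subr_ge0 exprn_ile1 // ltW.
rewrite ger0_norm ?exprn_ge0 ?(ltW a0) // mulr_ile1 ?exprn_ge0 ?(ltW a0) //.
- by rewrite subr_ge0 exprn_ile1 // ltW.
- by rewrite lerBlDr lerDl exprn_ge0 // ltW.
- by rewrite exprn_ile1 // ltW.
Qed.

Lemma moebius_denom (w : R[i]) s : `|w| <= s%:C -> s < 1 ->
  (1 - s)%:C <= `|1 - a%:C * w|.
Proof.
have /andP[a0 a1] := a01; move=> ws s1.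
apply: le_trans (lerB_dist _ _); rewrite normr1 rmorphB rmorph1 lerD2l lerN2.
rewrite normrM; apply: le_trans ws; apply: ler_piMl => //.
by rewrite normr_normc normc_real gtr0_norm // lecR ltW.
Qed.

(** The tail is geometric, hence has a closed form, and induction on [M] reduces to field
    identities. Its constant factor is the coefficient of index [M.+1], so it is at most 1 in
    modulus. *)
Lemma moebius_remainder (w : R[i]) M : 1 - a%:C * w != 0 ->
  moebius w - \sum_(k < M.+1) (moebius_coef k)%:C * w ^+ k =
  - ((1 - a ^+ 2) * a ^+ M)%:C * w ^+ M.+1 / (1 - a%:C * w).
Proof.
move=> aw; elim: M => [|M IH].
  rewrite big_ord_recl big_ord0 addr0 /= expr0 mulr1 /moebius expr1.
  rewrite !(rmorphM, rmorphB, rmorphXn, rmorph1, expr0) /=; field.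
  exact: aw.
rewrite big_ord_recr /= opprD addrA IH !exprS.
rewrite !(rmorphM, rmorphB, rmorphN, rmorphXn, rmorph1) /=; field.
exact: aw.
Qed.

Lemma moebius_taylor_dist (w : R[i]) s M : `|w| <= s%:C -> s < 1 ->
  `|moebius w - \sum_(k < M.+1) (moebius_coef k)%:C * w ^+ k|
   <= (s ^+ M.+1 / (1 - s))%:C.
Proof.
move=> ws s1; have s1' : 0 < (1 - s)%:C by rewrite ltcR subr_gt0.
have den := moebius_denom ws s1.
have den0 := lt_le_trans s1' den.
rewrite moebius_remainder -?normr_gt0 // normrM normfV.
rewrite ler_pdivrMr // [(s ^+ _ / _)%:C]rmorphM /= -mulrA -[X in X <= _]mulr1.
rewrite fmorphV; apply: ler_pM => //.
  rewrite normrM normrX -[X in _ <= X]mul1r rmorphXn; apply: ler_pM => //.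
    have := moebius_coef_le1 M.+1.
    by rewrite -rmorphN normr_normc normc_real lecR.
  by apply: lerXn2r => //; rewrite nnegrE // (le_trans _ ws).
by rewrite ler_pdivlMl // mulr1.
Qed.

(** This rests on [|1 - a w|^2 - |a - w|^2 = (1 - a^2) (1 - |w|^2) > 0]. *)
Lemma normc_moebius_lt1 (w : R[i]) : normc w < 1 -> normc (moebius w) < 1.
Proof.
have /andP[a0 a1] := a01; move=> w1; have w1' : `|w| <= (normc w)%:C by [].
have den := moebius_denom w1' w1.
have den0 : 0 < `|1 - a%:C * w|.
  by apply: lt_le_trans den; rewrite ltcR subr_gt0.
rewrite -ltcR /moebius -[X in X < _]/(`|(a%:C - w) / (1 - a%:C * w)|).
rewrite normrM normfV ltr_pdivrMr // rmorph1 mul1r.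
rewrite !normr_normc ltcR; case: w w1 {w1' den den0} => x y /= w1.
have xy : x ^+ 2 + y ^+ 2 < 1.
  rewrite -(@ltr_sqrt R _ 1) ?ltr01 // sqrtr1 //.
have a21 : 0 < 1 - a ^+ 2 by rewrite subr_gt0 exprn_ilt1 // ltW.
have pos : 0 < (1 - a ^+ 2) * (1 - (x ^+ 2 + y ^+ 2)).
  by rewrite mulr_gt0 // subr_gt0.
(* The zeros are the imaginary parts of [a] and 1, kept to match the unfolded complex operations. *)
have lt : (a - x) ^+ 2 + (0 - y) ^+ 2 <
    (1 - (a * x - 0 * y)) ^+ 2 + (0 - (a * y + 0 * x)) ^+ 2 by nra.
by rewrite ltr_sqrt // (le_lt_trans _ lt) // addr_ge0 ?sqr_ge0.
Qed.

End moebius.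

(** * Lower bound for the majorant *)

Section majorant.
Context {R : realType} {n : nat}.

(* For [degree al = 0] the division by zero is harmless: the power is [1]. *)
Lemma sup_monomial_ge (r y : R) (al : multi_index n) (c : R[i]) :
    0 <= y < r ->
  ((normc c * (y / (degree al)%:R) ^+ degree al)%:E <=
   ereal_sup [set (normc (c * monomial z al))%:E
             | z in dilate r (hypercone R n)])%E.
Proof.
move=> /andP[y0 yr]; have r0 : 0 < r by exact: le_lt_trans yr.
(* Up to the factor [y], the maximum of the monomial on the hypercone is
   attained at [al / degree al]. *)
set k := degree al; pose t i := y * (al i)%:R / k%:R.
have t0 i : 0 <= t i by rewrite /t divr_ge0 ?mulr_ge0.
have mon : monomial (\row_i (t i)%:C) al = (\prod_i t i ^+ al i)%:C.
  rewrite rmorph_prod; apply: eq_bigr => i _.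
  by rewrite mxE rmorphXn.
have P0 : 0 <= \prod_i t i ^+ al i.
  by apply: prodr_ge0 => i _; rewrite exprn_ge0.
apply: le_trans (ereal_sup_ubound
  (x := (normc (c * monomial (\row_i (t i)%:C) al))%:E) _).
  rewrite lee_fin normcM; apply: ler_wpM2l; first exact: normc_ge0.
  rewrite mon normc_real ger0_norm // -prodrXr.
  apply: ler_prod => i _; rewrite exprn_ge0 ?divr_ge0 //=.
  (* With exponent 0 both factors are 1; otherwise [al i >= 1] gives [y / k <= t i]. *)
  rewrite /t; case: (al i) => [|m]; first by rewrite !expr0.
  apply: lerXn2r; rewrite ?nnegrE ?divr_ge0 ?mulr_ge0 //.
  by rewrite ler_wpM2r ?invr_ge0 // ler_peMr // ler1n.
exists (\row_i (t i)%:C) => //.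
(* The moduli of this point add up to [y / r < 1], or to 0 when [k = 0]. *)
exists (\row_i (t i / r)%:C); last first.
  by apply/rowP => i; rewrite !mxE -rmorphM mulrC divfK ?gt_eqF.
rewrite /hypercone /=.
rewrite (eq_bigr (fun i => y / r / k%:R * (al i)%:R)); last first.
  move=> i _; rewrite mxE normc_real ger0_norm; first by rewrite /t; ring.
  by rewrite divr_ge0 // ltW.
rewrite -mulr_sumr -natr_sum -/(degree al) -/k.
have [->|k0] := eqVneq k 0%N; first by rewrite mulr0.
by rewrite divfK ?pnatr_eq0 // ltr_pdivrMr // mul1r.
Qed.

(** A finite subfamily bounds the sum of nonnegative terms from below. Counted by words, degree [k]
    contributes [n ^ k] equal terms, which produces the factor [n] inside the power. *)
Lemma majorant_sum_diagonal_ge (b : nat -> R) (r y : R) M : 0 <= y < r ->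
  ((\sum_(k < M) `|b k| * (n%:R * y / k%:R) ^+ k)%:E <=
   majorant_sum (hypercone R n) r (diagonal_coef b))%E.
Proof.
move=> yr; apply: esum_ge; exists [set` contents_below n M]%classic.
  by split => //; exact: finite_fset.
rewrite -fsbig_seq ?fset_uniq //=.
pose G (al : multi_index n) : R :=
  `|b (degree al)| * (y / (degree al)%:R) ^+ degree al.
have -> : \sum_(k < M) `|b k| * (n%:R * y / k%:R) ^+ k =
    \sum_(al <- contents_below n M) G al *+ multinomial al.
  rewrite (@sum_multinomial _ _ _ _ M); last first.
    by move=> al; exact: degree_contents_below.
  apply: eq_bigr => k _.
  rewrite (eq_bigr (fun=> `|b k| * (y / k%:R) ^+ k)); last first.
    by move=> f _; rewrite /G degree_content.
  rewrite (eq_bigl xpredT) ?sumr_const; last first.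
    by move=> f; rewrite content_in_contents_below.
  rewrite card_ffun !card_ord -[RHS]mulr_natr natrX -!mulrA; congr (_ * _).
  by rewrite exprMn mulrC.
rewrite -sumEFin; apply: lee_sum => al _.
have -> : G al *+ multinomial al =
    normc (diagonal_coef b al) * (y / (degree al)%:R) ^+ degree al.
  rewrite /diagonal_coef normcMn mulrnAl; congr (_ * _ *+ _).
  by rewrite normc_real.
exact: sup_monomial_ge.
Qed.

End majorant.

(** * The upper bound for the Bohr radius and its numerical value *)

Lemma bohr_radius_hypercone_le (R : realType) n (a y : R) M :
    0 < a < 1 -> 0 <= y ->
    1 <= \sum_(k < M) `|moebius_coef a k| * (n%:R * y / k%:R) ^+ k ->
  (bohr_radius (hypercone R n) <= y%:E)%E.
Proof.
move=> a01 y0 ge1; apply: ge_ereal_sup => _ [r [r0 br] <-].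
(* If some [r > y] had the Bohr property, the Moebius test function would have majorant below 1,
   against the assumed lower bound. *)
rewrite lee_fin leNgt; apply/negP => yr.
have cvg z : hypercone R n z ->
    (power_series_partial (diagonal_coef (moebius_coef a)) z @ totally -->
      (moebius a (\sum_i z ord0 i) : (R[i])^o))%classic.
  move=> z1; apply: diagonal_series_cvg => //.
    exact: moebius_coef_le1.
  move=> M'; apply: moebius_taylor_dist => //.
  by rewrite (le_trans (ler_norm_sum _ _ _)) // real_complex_sum.
have := br (diagonal_coef (moebius_coef a)).
rewrite ltNge => /(_ _ _)/negP; apply.
- by move=> z z1; apply/cvg_ex; eexists; exact: cvg z1.
- move=> z z1; rewrite /power_series_sum (norm_cvg_lim (cvg z z1)).
  apply: normc_moebius_lt1 => //.
  have : `|\sum_i z ord0 i| < 1%:C; last by rewrite normr_normc ltcR.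
  by apply: (le_lt_trans (ler_norm_sum _ _ _)); rewrite -real_complex_sum ltcR.
apply: le_trans (majorant_sum_diagonal_ge (moebius_coef a) M _).
  by rewrite lee_fin; exact: ge1.
by rewrite y0.
Qed.

(* [716 / 1603] lies just below [0.446663], and above the root [0.4466615...] of
   [\sum_(k >= 1) x ^+ k / k ^ k = 1 / 2]. *)
Lemma bohr_numeric (R : realType) (a := 1 - (10 ^+ 7)^-1 : R) :
  1 <= \sum_(k < 6) `|moebius_coef a k| * (716 / 1603 / k%:R) ^+ k.
Proof.
rewrite !big_ord_recr big_ord0 /=.
rewrite (_ : `|a| = a); last by rewrite ger0_norm // /a; lra.
have E k : `|- ((1 - a ^+ 2) * a ^+ k)| = (1 - a ^+ 2) * a ^+ k.
  rewrite normrN ger0_norm // mulr_ge0 ?exprn_ge0 // /a; lra.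
(* Only rational numbers are left. After division by [1 - a] the claim is [(1 + a) * S >= 1], with
   [S] the sum of [a^(k-1) (x / k)^k] for [k] from 1 to 5 and [x = 716 / 1603]. *)
rewrite !E /a; lra.
Qed.

Theorem theorem6 (R : realType) (n : nat) (n_ge1 : (1 <= n)%N) :
  (bohr_radius (hypercone R n) < (446663%:R / 1000000%:R / n%:R)%:E)%E.
Proof.
(* A value strictly below the stated constant turns the non-strict bound into a strict one. *)
pose x : R := 716 / 1603.
apply: (@le_lt_trans _ _ (x / n%:R)%:E).
  apply: (@bohr_radius_hypercone_le _ _ (1 - (10 ^+ 7)^-1) _ 6).
  - by apply/andP; split; lra.
  - by rewrite divr_ge0 // /x; lra.
  have -> : n%:R * (x / n%:R) = x by rewrite mulrC divfK // pnatr_eq0 -lt0n.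
  exact: bohr_numeric.
rewrite lte_fin ltr_pM2r ?invr_gt0 ?ltr0n // /x; lra.
Qed.
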